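(* Let $\Phi=(\phi_n)$, $\Psi=(\psi_n)$ be sequences in $\mathcal H$ and let $m=(m_n)$ be a complex scalar sequence. Consider the following conditions on $(m,\Phi,\Psi)$. $\mathcal P_1$: the sequence $(|m_n|\cdot\|\phi_n\|\cdot\|\psi_n\|)$ is norm-bounded below and $M_{m,\Phi,\Psi}$ is unconditionally convergent. $\mathcal P_2$: there exist scalar sequences $(c_n)$ and $(d_n)$ with $m_n=c_n\overline{d_n}$ for every $n$ such that $(c_n\phi_n)$ and $(d_n\psi_n)$ are $\|\cdot\|$-semi-normalized and Bessel for $\mathcal H$. $\mathcal P_3$: there exist scalar sequences $(c_n)$ and $(d_n)$ with $m_n=c_n\overline{d_n}$ for every $n$ such that $(c_n\phi_n)$ and $(d_n\psi_n)$ are Bessel for $\mathcal H$. Then $\mathcal P_1\Leftrightarrow\mathcal P_2$ and $\mathcal P_2\Rightarrow\mathcal P_3$, while $\mathcal P_3$ does not in general imply $\mathcal P_1$ (that is, there exist $m,\Phi,\Psi$ satisfying $\mathcal P_3$ but not $\mathcal P_1$).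
   Context: $\mathcal H$ is a complex Hilbert space having an orthonormal basis $(e_n)_{n\in\mathbb N}$ indexed by $\mathbb N$; all sequences and sums are indexed by $\mathbb N$. The multiplier is $M_{m,\Phi,\Psi}f=\sum_{n=1}^\infty m_n\langle f,\psi_n\rangle\phi_n$, where $\langle\cdot,\cdot\rangle$ is linear in the first argument. It is called unconditionally convergent if for every $f\in\mathcal H$ the series $\sum_n m_n\langle f,\psi_n\rangle\phi_n$ converges unconditionally (i.e. it converges for every permutation of its terms). A sequence $(x_n)$ of scalars or vectors is norm-bounded below if $\inf_n\|x_n\|>0$ (absolute value for scalars). A sequence $(\phi_n)$ in $\mathcal H$ is $\|\cdot\|$-semi-normalized if there are constants $0<a\le b<\infty$ with $a\le\|\phi_n\|\le b$ for all $n$. A sequence $(\phi_n)$ in $\mathcal H$ is Bessel for $\mathcal H$ if there is $B<\infty$ with $\sum_n|\langle h,\phi_n\rangle|^2\le B\|h\|^2$ for all $h\in\mathcal H$. *)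

(* Defs.v *)
From HB Require Import structures.
From mathcomp Require Import all_boot all_order all_algebra.
From mathcomp Require Import sesquilinear.
From mathcomp Require Import all_classical all_reals all_analysis.
From mathcomp Require Import complex.

Set Implicit Arguments.
Unset Strict Implicit.
Unset Printing Implicit Defensive.

Import Order.TTheory GRing.Theory Num.Theory.
Import numFieldNormedType.Exports.

Local Open Scope classical_set_scope.
Local Open Scope ring_scope.

(* The norm of a normed space over R[i] takes its values in R[i] (they are
   real and nonnegative there); rnorm is the same norm with values in R. *)
Definition rnorm (R : realType) (V : normedZmodType R[i]) (x : V) : R :=
  complex.Re `|x|.

(* A complex Hilbert space is a Banach space H over R[i] together with an inner
   product dot that induces its norm. {dot H for Num.conj} is the type of
   positive definite Hermitian forms; they are linear in the first argument and
   conjugate-linear in the second. *)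
Definition induces_norm (R : realType) (H : completeNormedModType R[i])
    (dot : {dot H for @Num.conj R[i]}) : Prop :=
  forall x : H, `|x| ^+ 2 = dot x x.

Definition orthonormal_basis (R : realType) (H : completeNormedModType R[i])
    (dot : {dot H for @Num.conj R[i]}) (e : nat -> H) : Prop :=
  (forall i j : nat, dot (e i) (e j) = (i == j)%:R) /\
  (forall x : H, series (fun n => dot x (e n) *: e n) @ \oo --> x).

Definition norm_bounded_below (R : realType) (V : normedZmodType R[i])
    (x : nat -> V) : Prop :=
  0 < inf (range (fun n => rnorm (x n))).

Definition semi_normalized (R : realType) (V : normedZmodType R[i])
    (x : nat -> V) : Prop :=
  exists a b : R, [/\ 0 < a, a <= b & forall n, a <= rnorm (x n) <= b].

Definition Bessel (R : realType) (H : completeNormedModType R[i])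
    (dot : {dot H for @Num.conj R[i]}) (x : nat -> H) : Prop :=
  exists B : R, forall h : H,
    (\sum_(0 <= n <oo) (rnorm (dot h (x n)) ^+ 2)%:E
       <= (B * rnorm h ^+ 2)%:E)%E.

Definition unconditionally_convergent (R : realType) (V : normedModType R[i])
    (x : nat -> V) : Prop :=
  forall s : nat -> nat, bijective s -> cvgn (series (x \o s)).

Definition multiplier_term (R : realType) (H : completeNormedModType R[i])
    (dot : {dot H for @Num.conj R[i]}) (m : nat -> R[i]) (phi psi : nat -> H)
    (f : H) (n : nat) : H :=
  (m n * dot f (psi n)) *: phi n.

Definition multiplier_unconditionally_convergent (R : realType)
    (H : completeNormedModType R[i]) (dot : {dot H for @Num.conj R[i]})
    (m : nat -> R[i]) (phi psi : nat -> H) : Prop :=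
  forall f : H, unconditionally_convergent (multiplier_term dot m phi psi f).

Definition P1 (R : realType) (H : completeNormedModType R[i])
    (dot : {dot H for @Num.conj R[i]})
    (m : nat -> R[i]) (phi psi : nat -> H) : Prop :=
  norm_bounded_below (fun n => `|m n| * `|phi n| * `|psi n| : R[i]) /\
  multiplier_unconditionally_convergent dot m phi psi.

Definition P2 (R : realType) (H : completeNormedModType R[i])
    (dot : {dot H for @Num.conj R[i]})
    (m : nat -> R[i]) (phi psi : nat -> H) : Prop :=
  exists c d : nat -> R[i],
    [/\ forall n, m n = c n * Num.conj (d n),
        semi_normalized (fun n => c n *: phi n) /\
          Bessel dot (fun n => c n *: phi n)
      & semi_normalized (fun n => d n *: psi n) /\
          Bessel dot (fun n => d n *: psi n)].

Definition P3 (R : realType) (H : completeNormedModType R[i])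
    (dot : {dot H for @Num.conj R[i]})
    (m : nat -> R[i]) (phi psi : nat -> H) : Prop :=
  exists c d : nat -> R[i],
    [/\ forall n, m n = c n * Num.conj (d n),
        Bessel dot (fun n => c n *: phi n)
      & Bessel dot (fun n => d n *: psi n)].

(* Main.v *)
(** If [M] converges unconditionally, then for each [f] all sums of its terms
over finite sets are bounded, so by uniform boundedness the finite signed sums
[sum_n +-m_n <f, psi_n> phi_n] have norm at most [C |f|], with [C] independent
of the signs. Their adjoints [sum_n +-conj(m_n) <g, phi_n> psi_n] satisfy the
same bound. For suitable signs the squared norm of a signed sum dominates the
sum of the squared norms of its terms, so [(conj(m_n) |phi_n| psi_n)] and
[(m_n |psi_n| phi_n)] are Bessel. When [|m_n| |phi_n| |psi_n|] is bounded below,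
[c_n = 1/|phi_n|] and [d_n = conj(m_n) |phi_n|] therefore witness P2.
Conversely, under P2 the terms of [M f] are [<f, d_n psi_n> c_n phi_n] with
square summable coefficients, and Bessel sequences are stable under
permutations. Taking everything zero separates P3 from P1. *)

From HB Require Import structures.
Require Import Defs.
From mathcomp Require Import all_boot all_order all_algebra.
From mathcomp Require Import sesquilinear.
From mathcomp Require Import all_classical all_reals all_analysis.
From mathcomp Require Import complex.
From mathcomp Require Import ring lra zify.

Import Order.TTheory GRing.Theory Num.Theory.
Import numFieldNormedType.Exports.

Local Open Scope ring_scope.

Set Implicit Arguments.
Unset Strict Implicit.
Unset Printing Implicit Defensive.

(** * The real-valued norm and convergence *)

Lemma normrE (R : realType) (V : normedZmodType R[i]) (x : V) :
  `|x| = ((rnorm x)%:C)%C.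
Proof. by rewrite /rnorm RRe_real // normr_real. Qed.

Lemma rnorm_ge0 (R : realType) (V : normedZmodType R[i]) (x : V) : 0 <= rnorm x.
Proof. by rewrite -lecR -normrE normr_ge0. Qed.

Lemma ler_rnormD (R : realType) (V : normedZmodType R[i]) (x y : V) :
  rnorm (x + y) <= rnorm x + rnorm y.
Proof. by rewrite -lecR rmorphD /= -!normrE ler_normD. Qed.

Lemma rnormN (R : realType) (V : normedZmodType R[i]) (x : V) :
  rnorm (- x) = rnorm x.
Proof. by rewrite /rnorm normrN. Qed.

Lemma rnormB (R : realType) (V : normedZmodType R[i]) (x y : V) :
  rnorm (x - y) = rnorm (y - x).
Proof. by rewrite /rnorm distrC. Qed.

Lemma rnorm0 (R : realType) (V : normedZmodType R[i]) : rnorm (0 : V) = 0.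
Proof. by rewrite /rnorm normr0. Qed.

Lemma rnorm_eq0 (R : realType) (V : normedZmodType R[i]) (x : V) :
  rnorm x = 0 -> x = 0.
Proof. by move=> x0; apply/eqP; rewrite -normr_eq0 normrE x0. Qed.

Lemma ler_rnorm_sum (R : realType) (V : normedZmodType R[i]) (I : Type)
    (r : seq I) (P : pred I) (F : I -> V) :
  rnorm (\sum_(i <- r | P i) F i) <= \sum_(i <- r | P i) rnorm (F i).
Proof.
elim/big_rec2: _ => [|i y x _ le_xy]; first by rewrite rnorm0.
by rewrite (le_trans (ler_rnormD _ _))// lerD2l.
Qed.

Lemma rnormM (R : realType) (a b : R[i]) : rnorm (a * b) = rnorm a * rnorm b.
Proof. by apply: complexI; rewrite rmorphM /= -!normrE normrM. Qed.

Lemma rnormZ (R : realType) (V : normedModType R[i]) (a : R[i]) (x : V) :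
  rnorm (a *: x) = rnorm a * rnorm x.
Proof. by apply: complexI; rewrite rmorphM /= -!normrE normrZ. Qed.

Lemma rnorm_norm (R : realType) (V : normedZmodType R[i]) (x : V) :
  rnorm `|x| = rnorm x.
Proof. by rewrite /rnorm normr_id. Qed.

Lemma rnorm_conj (R : realType) (a : R[i]) : rnorm (Num.conj a) = rnorm a.
Proof. by rewrite /rnorm norm_conjC. Qed.

Lemma rnorm_real (R : realType) (r : R) : rnorm (r%:C)%C = `|r|.
Proof. by rewrite /rnorm normc_def /= expr0n addr0 sqrtr_sqr. Qed.

Lemma ler_Re_rnorm (R : realType) (a : R[i]) : complex.Re a <= rnorm a.
Proof.
by rewrite (le_trans (ler_norm _))// -lecR -normrE normc_ge_Re.
Qed.

(** By completeness it suffices to be Cauchy, and comparing with the single term [u N] costs only a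
    factor two in [e]. *)
Lemma cvgn_rnormP (R : realType) (V : completeNormedModType R[i])
    (u : nat -> V) :
  cvgn u <-> forall e : R, 0 < e -> exists N : nat, forall n, (N <= n)%N ->
    rnorm (u n - u N) < e.
Proof.
split=> [cu e e0|cu].
  have e20 : 0 < ((e / 2)%:C)%C :> R[i] by rewrite ltcR divr_gt0.
  have /cvgrPdist_lt/(_ _ e20)[N _ uN] := cu.
  exists N => n Nn; have := uN n Nn; have := uN N (leqnn N).
  rewrite /= !normrE !ltcR rnormB => lN.
  rewrite rnormB => ln.
  rewrite -[u n](subrK (limn u)) -addrA.
  by rewrite (le_lt_trans (ler_rnormD _ _))// [e]splitr ltrD// rnormB.
apply/cauchy_cvgP/cauchyP => e e0.
have eR : (complex.Re e)%:C%C = e by rewrite RRe_real// gtr0_real.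
have [|N uN] := cu (complex.Re e); first by rewrite -ltcR eR.
exists (u N), N => // n /= Nn.
by rewrite -ball_normE /= normrE -eR ltcR rnormB uN.
Qed.

Lemma cvgn_rnorm (R : realType) (V : normedModType R[i]) (u : nat -> V) (l : V) :
  (u @ \oo --> l)%classic -> forall e : R, 0 < e ->
    exists N : nat, forall n, (N <= n)%N -> rnorm (l - u n) < e.
Proof.
move=> /cvgrPdist_lt ul e e0.
have [|N _ uN] := ul (e%:C)%C; first by rewrite ltcR.
by exists N => n /uN; rewrite /= normrE ltcR.
Qed.

(** * Inner products and the Cauchy-Schwarz inequality *)

Lemma dotC (R : realType) (H : completeNormedModType R[i])
    (dot : {dot H for @Num.conj R[i]}) (u v : H) :
  dot u v = Num.conj (dot v u).
Proof. by rewrite hermC expr0 mul1r. Qed.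

Lemma dotZl (R : realType) (H : completeNormedModType R[i])
    (dot : {dot H for @Num.conj R[i]}) (a : R[i]) (u v : H) :
  dot (a *: u) v = a * dot u v.
Proof. exact: linearZl_LR. Qed.

Lemma dotZr (R : realType) (H : completeNormedModType R[i])
    (dot : {dot H for @Num.conj R[i]}) (a : R[i]) (u v : H) :
  dot u (a *: v) = Num.conj a * dot u v.
Proof. exact: linearZr_LR. Qed.

Lemma dot_rnorm (R : realType) (H : completeNormedModType R[i])
    (dot : {dot H for @Num.conj R[i]}) (Hdot : induces_norm dot) (u : H) :
  dot u u = ((rnorm u ^+ 2)%:C)%C.
Proof. by rewrite -Hdot normrE rmorphXn. Qed.

Lemma Re_dotC (R : realType) (H : completeNormedModType R[i])
    (dot : {dot H for @Num.conj R[i]}) (u v : H) :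
  complex.Re (dot u v) = complex.Re (dot v u).
Proof. by rewrite dotC; case: (dot v u). Qed.

Lemma rnormD_sqr (R : realType) (H : completeNormedModType R[i])
    (dot : {dot H for @Num.conj R[i]}) (Hdot : induces_norm dot) (u v : H) :
  rnorm (u + v) ^+ 2 = rnorm u ^+ 2 + rnorm v ^+ 2 + 2 * complex.Re (dot u v).
Proof.
suff E : complex.Re (dot (u + v) (u + v)) =
    complex.Re (dot u u) + complex.Re (dot v v) + 2 * complex.Re (dot u v).
  by move: E; rewrite !(dot_rnorm Hdot).
rewrite linearDl !linearDr !raddfD /= [complex.Re (dot v u)]Re_dotC; ring.
Qed.

Lemma Cauchy_Schwarz (R : realType) (H : completeNormedModType R[i])
    (dot : {dot H for @Num.conj R[i]}) (Hdot : induces_norm dot) (u v : H) :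
  rnorm (dot u v) <= rnorm u * rnorm v.
Proof.
have [v0|v0] := eqVneq (rnorm v) 0.
  by rewrite (rnorm_eq0 v0) linear0r !rnorm0 mulr0.
have vgt0 : 0 < rnorm v ^+ 2 by rewrite exprn_gt0// lt_neqAle eq_sym v0 rnorm_ge0.
rewrite -ler_sqr ?nnegrE ?mulr_ge0 ?rnorm_ge0// exprMn.
(* This vector is [rnorm v ^+ 2] times the component of [u] orthogonal to [v]; its squared norm is
   [rnorm v ^+ 2] times the gap in the squared inequality. *)
have := sqr_ge0 (rnorm ((rnorm v ^+ 2)%:C%C *: u + (- dot u v) *: v)).
rewrite (rnormD_sqr Hdot) !rnormZ dotZl dotZr rnormN rnorm_real.
rewrite ger0_norm ?sqr_ge0//.
rewrite raddfN /= mulNr [Num.conj _ * _]mulrC.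
rewrite -normCK normrE mulrN -rmorphXn -rmorphM raddfN /=.
nra.
Qed.

(** * Bessel bounds on partial sums, and signed sums *)

Lemma BesselP (R : realType) (H : completeNormedModType R[i])
    (dot : {dot H for @Num.conj R[i]}) (x : nat -> H) :
  Bessel dot x <-> exists B : R, forall (h : H) (N : nat),
    \sum_(0 <= n < N) rnorm (dot h (x n)) ^+ 2 <= B * rnorm h ^+ 2.
Proof.
have ge0 h n : (0 <= (rnorm (dot h (x n)) ^+ 2)%:E)%E by rewrite lee_fin sqr_ge0.
split=> -[B xB]; exists B => h.
  move=> N; rewrite -lee_fin -sumEFin (le_trans _ (xB h))//.
  exact: nneseries_lim_ge.
apply: lime_le; first exact: is_cvg_nneseries.
by apply: nearW => N; rewrite sumEFin lee_fin.
Qed.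

(* Each sign is chosen to make the cross term with the previous sum nonnegative. *)
Lemma sum_signs_ge (R : realType) (H : completeNormedModType R[i])
    (dot : {dot H for @Num.conj R[i]}) (Hdot : induces_norm dot)
    (x : nat -> H) (N : nat) :
  exists p : pred nat, \sum_(0 <= n < N) rnorm (x n) ^+ 2 <=
    rnorm (\sum_(0 <= n < N) (-1) ^+ p n *: x n) ^+ 2.
Proof.
elim: N => [|N [p IH]]; first by exists pred0; rewrite !big_nil sqr_ge0.
set S := \sum_(0 <= n < N) _ *: _ in IH.
exists (fun n => if n == N then complex.Re (dot S (x N)) < 0 else p n).
rewrite !big_nat_recr //= eqxx.
under [X in rnorm (X + _)]eq_big_nat => n /andP[_ nN] do rewrite ltn_eqF//.
rewrite -/S (rnormD_sqr Hdot).
have [dSx|dSx] := ltP (complex.Re (dot S (x N))) 0.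
  by rewrite expr1 scaleN1r rnormN linearNr raddfN/=; lra.
by rewrite expr0 scale1r; lra.
Qed.

(** Reduces signed sums to the plain subsums that unconditional convergence controls. *)
Lemma sum_signsE (R : realType) (V : lmodType R[i]) (x : nat -> V)
    (p : pred nat) (N : nat) :
  \sum_(0 <= n < N) (-1) ^+ p n *: x n =
  \sum_(0 <= n < N | ~~ p n) x n - \sum_(0 <= n < N | p n) x n.
Proof.
rewrite (bigID p) /= addrC -sumrN.
by congr (_ + _); apply: eq_bigr => n; [move/negPf|] => ->;
  rewrite (expr0, expr1) (scale1r, scaleN1r).
Qed.

(** * Uniform boundedness *)

(* Otherwise one finds nested balls on whose n-th member some [T i] exceeds [n]
   in norm; their common point contradicts pointwise boundedness. *)
Lemma uniform_boundedness (R : realType) (V : completeNormedModType R[i])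
    (W : normedModType R[i])
    (I : Type) (T : I -> V -> W) :
  (forall i, linear (T i)) ->
  (forall i, exists C : R, forall x, rnorm (T i x) <= C * rnorm x) ->
  (forall x, exists M : R, forall i, rnorm (T i x) <= M) ->
  exists C : R, forall i x, rnorm (T i x) <= C * rnorm x.
Proof.
move=> Tlin; pose T' i : {linear V -> W} :=
  HB.pack (T i) (GRing.isLinear.Build _ _ _ _ (T i) (Tlin i)).
have -> : T = T' by [].
move: T' => {Tlin} {}T Tbnd Tpt; apply: contrapT => unbounded.
have large (C : R) : exists i x, C * rnorm x < rnorm (T i x).
  apply: contrapT => nlarge; apply: unbounded; exists C => i x.
  by rewrite leNgt; apply/negP => lt; apply: nlarge; exists i, x.
(* A pair encodes a ball by centre and radius. Positivity of the old radius is a premise inside the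
   existential, so that [choice] gives a total function. *)
have step (n : nat) (b : V * R) : exists b' : V * R, 0 < b.2 ->
    [/\ 0 < b'.2, b'.2 <= n.+1%:R^-1, rnorm (b'.1 - b.1) + b'.2 <= b.2 &
        exists i, forall y, rnorm (y - b'.1) <= b'.2 -> n%:R <= rnorm (T i y)].
  have [b0|] := ltP 0 b.2; last by exists b.
  (* The factor is such that rescaling [z] to norm [b.2 / 2] gives a [w] whose image has norm above
     [n + 1]. *)
  have [i [z Tz]] := large ((n%:R + 1) * (2 / b.2)).
  have z0 : 0 < rnorm z.
    rewrite lt_neqAle rnorm_ge0 eq_sym andbT; apply/eqP => z0.
    by move: Tz; rewrite (rnorm_eq0 z0) linear0 !rnorm0 mulr0 ltxx.
  have [C TC] := Tbnd i.
  pose w := ((b.2 / 2 / rnorm z)%:C)%C *: z.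
  have w_b : rnorm w = b.2 / 2.
    by rewrite rnormZ rnorm_real ger0_norm ?divfK ?gt_eqF// ?divr_ge0// ltW.
  have Tw : n%:R + 1 < rnorm (T i w).
    rewrite linearZ rnormZ rnorm_real ger0_norm; last by rewrite !divr_ge0// ltW.
    rewrite mulrC -ltr_pdivrMr ?divr_gt0// (le_lt_trans _ Tz)//.
    by rewrite invfM invrK !invf_div [leLHS]mulrA.
  (* The three bounds on the radius serve, in order, to keep the new ball inside the old one, to
     make the radii tend to zero, and to let [T i] vary by at most 1 from the centre. *)
  pose r := Num.min (b.2 / 2) (Num.min (n.+1%:R^-1) ((`|C| + 1)^-1)).
  have r0 : 0 < r by rewrite !lt_min divr_gt0//= !invr_gt0 ltr0n/= ltr_wpDl.
  have rC : `|C| * r <= 1.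
    have C1 : 0 < `|C| + 1 by rewrite ltr_wpDl.
    have : (`|C| + 1) * r <= (`|C| + 1) * (`|C| + 1)^-1.
      by rewrite ler_pM2l// /r !ge_min lexx !orbT.
    rewrite divff ?gt_eqF//; nra.
  (* The images of [b.1 + w] and [b.1 - w] differ by twice [T i w], so at least one of them has norm
     above [n + 1]. *)
  have [w' w'_b Tw'] : exists2 w', rnorm w' = b.2 / 2 &
      n%:R + 1 < rnorm (T i (b.1 + w')).
    have [|le1] := ltP (n%:R + 1) (rnorm (T i (b.1 + w))); first by exists w.
    exists (- w); first by rewrite rnormN.
    have := ler_rnormD (T i (b.1 + w)) (- T i (b.1 - w)).
    rewrite rnormN -linearB opprD addrACA subrr add0r opprK -mulr2n linearMn.
    have -> : rnorm (T i w *+ 2) = 2 * rnorm (T i w).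
      by rewrite -scaler_nat rnormZ /rnorm normr_nat.
    lra.
  exists (b.1 + w', r) => _; split=> //=.
  - by rewrite /r !ge_min lexx !orbT.
  - have : r <= b.2 / 2 by rewrite /r ge_min lexx.
    by rewrite addrAC subrr add0r w'_b; lra.
  - exists i => y yr.
    have Ty : rnorm (T i (b.1 + w') - T i y) <= 1.
      rewrite -linearB (le_trans (TC _))// rnormB (le_trans _ rC)//.
      by rewrite (le_trans (ler_wpM2r (rnorm_ge0 _) (ler_norm C)))// ler_wpM2l.
    have := ler_rnormD (T i (b.1 + w') - T i y) (T i y).
    by rewrite subrK; lra.
have [f fP] := choice (fun nb : nat * (V * R) => step nb.1 nb.2).
pose b := fix b n := if n is n'.+1 then f (n', b n') else (0 : V, 1 : R).
have b0 n : 0 < (b n).2.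
  by elim: n => [|n IH] //; have [] := fP (n, b n) IH.
have nested k n : rnorm ((b (n + k)%N).1 - (b n).1) + (b (n + k)%N).2 <= (b n).2.
  elim: k => [|k IH]; first by rewrite addn0 subrr rnorm0 add0r.
  have [_ _ le_b _] := fP ((n + k)%N, b (n + k)%N) (b0 _).
  rewrite addnS -[X in X - _](subrK (b (n + k)%N).1) -addrA.
  move: (ler_rnormD ((b (n + k).+1).1 - (b (n + k)%N).1)
    ((b (n + k)%N).1 - (b n).1)) IH le_b => /=; lra.
have inb k n : rnorm ((b (n + k)%N).1 - (b n).1) <= (b n).2.
  by move: (nested k n) (b0 (n + k)%N); lra.
have bS n : (b n.+1).2 <= n.+1%:R^-1 by have [] := fP (n, b n) (b0 n).
have /cvgn_rnorm cvb : cvgn (fun n => (b n).1).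
  apply/cvgn_rnormP => e e0.
  have [N Ne] : exists N : nat, N.+1%:R^-1 < e.
    exists (Num.bound e^-1); rewrite invf_plt ?posrE//.
    rewrite (lt_trans (archi_boundP _)) ?ltr_nat// invr_ge0 ltW//.
  exists N.+1 => n /subnKC <-.
  by rewrite (le_lt_trans (inb _ _))// (le_lt_trans (bS _)).
set l := limn _ in cvb.
(* All later centres lie in the closed ball [b n], hence so does their limit. *)
have lb n : rnorm (l - (b n).1) <= (b n).2.
  rewrite leNgt; apply/negP => lt; rewrite -subr_gt0 in lt.
  have [N /(_ (n + N)%N)] := cvb _ lt.
  rewrite leq_addl => /(_ isT).
  have := ler_rnormD (l - (b (n + N)%N).1) ((b (n + N)%N).1 - (b n).1).
  by rewrite addrA subrK; move: (inb N n); lra.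
have [M TM] := Tpt l.
(* The index is chosen above [M]: on the next ball, which contains [l], some [T i] has norm
   exceeding [M]. *)
have [_ _ _ [i Ti]] := fP ((Num.bound `|M|).+1, b (Num.bound `|M|).+1) (b0 _).
have /= := Ti l (lb (Num.bound `|M|).+2).
have := archi_boundP (normr_ge0 M); have := TM i; have := ler_norm M.
rewrite -natr1; lra.
Qed.

(** * Bounded subsums from unconditional convergence *)

(* Otherwise every tail contains a finite set with a sum of norm at least [1];
   the permutation that moves such sets to the front of successive blocks of
   indices yields a series that is not Cauchy. *)
Lemma unconditional_subsums_bounded (R : realType)
    (V : completeNormedModType R[i]) (x : nat -> V) :
  unconditionally_convergent x ->
  exists M : R, forall (N : nat) (p : pred nat),
    rnorm (\sum_(0 <= n < N | p n) x n) <= M.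
Proof.
move=> xuc; apply: contrapT => unbounded.
have large (M : R) : exists N p, M < rnorm (\sum_(0 <= n < N | p n) x n).
  apply: contrapT => nlarge; apply: unbounded; exists M => N p.
  by rewrite leNgt; apply/negP => lt; apply: nlarge; exists N, p.
(* [b.1] is the set with a large sum and [b.2] holds the skipped indices, so that together they fill
   an interval starting at [K]. *)
have block (K : nat) : exists b : seq nat * seq nat,
    perm_eq (b.1 ++ b.2) (iota K (size b.1 + size b.2)) /\
    1 <= rnorm (\sum_(n <- b.1) x n).
  have le_K N p : (N <= K)%N -> rnorm (\sum_(0 <= n < N | p n) x n) <=
      \sum_(0 <= n < K) rnorm (x n).
    move=> NK; rewrite (le_trans (ler_rnorm_sum _ _ _))//.
    rewrite [leRHS](big_cat_nat _ NK)//= ler_wpDr ?sumr_ge0// => [n _|].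
      exact: rnorm_ge0.
    by rewrite big_mkcond ler_sum// => n _; case: ifP => // _; exact: rnorm_ge0.
  (* Exceeding the total norm of the first [K] terms by one rules out [N <= K] and leaves the chosen
     terms from [K] on with a sum of norm at least one. *)
  have [N [p]] := large (\sum_(0 <= n < K) rnorm (x n) + 1).
  have [NK|KN] := leqP N K.
    by move/lt_le_trans => /(_ _ (le_K N p NK)); rewrite ltNge lerDl ler01.
  rewrite (big_cat_nat _ (ltnW KN))//= => lt.
  exists ([seq n <- iota K (N - K) | p n], [seq n <- iota K (N - K) | ~~ p n]).
  rewrite !size_filter count_predC size_iota /= big_filter.
  split; first exact/permPl/perm_filterC.
  move: lt (le_K K p (leqnn K)) (ler_rnormD (\sum_(0 <= n < K | p n) x n)
    (\sum_(K <= n < N | p n) x n)).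
  by rewrite /index_iota; lra.
have [g gP] := choice block.
(* [P k] lists the first [k] blocks, a rearrangement of an initial segment of the naturals. Blocks
   are nonempty, since an empty sum has norm below one, so [P i.+1] is long enough to define
   [s i]. *)
pose P := fix P k := if k is k'.+1 then
  P k' ++ (g (size (P k'))).1 ++ (g (size (P k'))).2 else [::].
have PS k : P k.+1 = P k ++ (g (size (P k))).1 ++ (g (size (P k))).2 by [].
have permP k : perm_eq (P k) (iota 0 (size (P k))).
  elim: k => [|k IH] //; rewrite PS !size_cat iotaD add0n perm_cat//.
  by have [] := gP (size (P k)).
have sizeP k : (k <= size (P k))%N.
  elim: k => [|k IH] //; rewrite PS !size_cat.
  have : (0 < size (g (size (P k))).1)%N.
    have [_] := gP (size (P k)); case: (g _).1 => //=.
    by rewrite big_nil rnorm0 ler10.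
  by lia.
have prefixP k l : exists t, P (k + l)%N = P k ++ t.
  elim: l => [|l [t IH]]; first by exists [::]; rewrite addn0 cats0.
  by rewrite addnS PS IH -catA; eexists; reflexivity.
have nthP k l i : (i < size (P k))%N -> nth 0%N (P (k + l)%N) i = nth 0%N (P k) i.
  by move=> ik; have [t ->] := prefixP k l; rewrite nth_cat ik.
pose s i := nth 0%N (P i.+1) i.
have sE k i : (i < size (P k))%N -> s i = nth 0%N (P k) i.
  move=> ik; rewrite -(nthP _ i.+1 _ ik) addnC nthP//.
have sbij : bijective s.
  have mP m : m \in P m.+1.
    by rewrite (perm_mem (permP _)) mem_iota add0n (leq_trans _ (sizeP m.+1)).
  have sK m : s (index m (P m.+1)) = m.
    by rewrite (sE m.+1) ?index_mem// nth_index.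
  (* Injectivity comes from comparing two positions in one list [P] long enough for both, whose
     entries are distinct. *)
  exists (fun m => index m (P m.+1)) => // i.
  apply/eqP; set j := index _ _.
  have sj : s j = s i by rewrite sK.
  have iP : (i < size (P (maxn i j).+1))%N.
    by rewrite (leq_trans _ (sizeP _))// ltnS leq_maxl.
  have jP : (j < size (P (maxn i j).+1))%N.
    by rewrite (leq_trans _ (sizeP _))// ltnS leq_maxr.
  rewrite -(nth_uniq 0%N jP iP) -?sE ?sj//.
  by rewrite (perm_uniq (permP _)) iota_uniq.
have seriesE k n : (n <= size (P k))%N ->
    series (x \o s) n = \sum_(i <- take n (P k)) x i.
  move=> nk; rewrite seriesEnat /= [RHS](big_nth 0%N) size_takel//.
  apply: eq_big_nat => i /andP[_ iN] /=.
  by rewrite nth_take// (sE k)// (leq_trans iN).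
have e0 : 0 < (2^-1 : R) by rewrite invr_gt0.
have /cvgn_rnormP/(_ _ e0)[N sN] := xuc s sbij.
(* Past [N], the partial sums at the start of a block and after its large part differ by at least 1,
   while each is within one half of the sum at [N]. *)
pose n1 := size (P N); pose b := (g n1).1.
have /sN lt1 : (N <= n1)%N := sizeP N.
have /sN lt2 : (N <= n1 + size b)%N := leq_trans (sizeP N) (leq_addr _ _).
have [_ b1] := gP n1; rewrite -/b in b1.
have S1 : series (x \o s) n1 = \sum_(i <- P N) x i.
  by rewrite (seriesE N)// take_size.
have : series (x \o s) (n1 + size b)%N = \sum_(i <- P N) x i + \sum_(i <- b) x i.
  rewrite (seriesE N.+1); last by rewrite PS !size_cat leq_add2l leq_addr.
  by rewrite PS catA -size_cat take_size_cat// big_cat.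
rewrite -S1 => S2; move: lt2.
rewrite rnormB => lt2.
have := ler_rnormD (series (x \o s) n1 - series (x \o s) N)
  (series (x \o s) N - series (x \o s) (n1 + size b)%N).
rewrite addrA subrK S2 opprD addrA subrr add0r rnormN.
by rewrite S2 opprD in lt2; move: b1 lt1 lt2; lra.
Qed.

(** * Rearrangement and synthesis of Bessel sequences *)

(** A partial sum along [s] runs over distinct indices, so it is at most a longer partial sum of the
    original nonnegative series. *)
Lemma Bessel_comp_inj (R : realType) (H : completeNormedModType R[i])
    (dot : {dot H for @Num.conj R[i]}) (x : nat -> H) (s : nat -> nat) :
  injective s -> Bessel dot x -> Bessel dot (x \o s).
Proof.
move=> sI /BesselP[B xB]; apply/BesselP; exists B => h N.
pose M := (\max_(i < N) s i).+1.
rewrite (le_trans _ (xB h M))//.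
rewrite -(big_map s xpredT (fun n => rnorm (dot h (x n)) ^+ 2)).
have uniqs : uniq [seq s i | i <- index_iota 0 N].
  by rewrite map_inj_uniq// iota_uniq.
rewrite (perm_big [seq n <- index_iota 0 M | n \in [seq s i | i <- index_iota 0 N]]).
  rewrite big_filter big_mkcond ler_sum// => n _.
  by case: ifP => // _; exact: sqr_ge0.
apply: uniq_perm => //; first by rewrite filter_uniq// iota_uniq.
move=> n; rewrite mem_filter andb_idr// => /mapP[k].
rewrite !mem_index_iota => kN ->; rewrite ltnS /=.
exact: (leq_bigmax (Ordinal kN)).
Qed.

Lemma Bessel_synthesis_le (R : realType) (H : completeNormedModType R[i])
    (dot : {dot H for @Num.conj R[i]}) (Hdot : induces_norm dot)
    (x : nat -> H) :
  Bessel dot x -> exists2 B : R, 0 < B & forall (c : nat -> R[i]) (N n : nat),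
    (N <= n)%N -> rnorm (\sum_(N <= k < n) c k *: x k) ^+ 2 <=
      B * \sum_(N <= k < n) rnorm (c k) ^+ 2.
Proof.
move=> /BesselP[B' xB']; pose B := `|B'| + 1.
have B0 : 0 < B by rewrite ltr_wpDl.
exists B => // c N n Nn; set v := \sum_(_ <= _ < _) _ *: _.
have xB : \sum_(N <= k < n) rnorm (dot v (x k)) ^+ 2 <= B * rnorm v ^+ 2.
  apply: le_trans (_ : B' * rnorm v ^+ 2 <= _); last first.
    by rewrite ler_wpM2r ?sqr_ge0// /B; move: (ler_norm B'); lra.
  apply: le_trans (xB' v n); rewrite [leRHS](big_cat_nat _ Nn)//=.
  by rewrite lerDr sumr_ge0// => k _; exact: sqr_ge0.
(* Expanding one [v] in [dot v v] and applying the weighted inequality 2ab <= B a^2 + b^2 / B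
   termwise gives this bound; by [xB] its last term is at most [rnorm v ^+ 2] and is absorbed. *)
suff : 2 * rnorm v ^+ 2 <= B * \sum_(N <= k < n) rnorm (c k) ^+ 2 +
    B^-1 * \sum_(N <= k < n) rnorm (dot v (x k)) ^+ 2.
  have : B^-1 * \sum_(N <= k < n) rnorm (dot v (x k)) ^+ 2 <= rnorm v ^+ 2.
    by rewrite mulrC ler_pdivrMr// mulrC.
  lra.
have -> : rnorm v ^+ 2 = complex.Re (dot v v) by rewrite (dot_rnorm Hdot).
rewrite {1}/v linear_sumlz raddf_sum /= !mulr_sumr -big_split /=.
apply: ler_sum => k _; rewrite dotZl.
have := ler_Re_rnorm (c k * dot (x k) v).
rewrite rnormM dotC rnorm_conj.
move: (rnorm (c k)) (rnorm (dot v (x k))) => a b le_ab.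
have : 0 <= B^-1 * (B * a - b) ^+ 2 by rewrite mulr_ge0 ?sqr_ge0// invr_ge0 ltW.
have -> : B^-1 * (B * a - b) ^+ 2 = B * a ^+ 2 + B^-1 * b ^+ 2 - 2 * (a * b).
  by field; rewrite gt_eqF.
lra.
Qed.

(** The synthesis bound dominates blocks of the series by blocks of the convergent series of squared
    coefficients. *)
Lemma Bessel_series_cvg (R : realType) (H : completeNormedModType R[i])
    (dot : {dot H for @Num.conj R[i]}) (Hdot : induces_norm dot)
    (x : nat -> H) (c : nat -> R[i]) (M : R) :
  Bessel dot x -> (forall N, \sum_(0 <= n < N) rnorm (c n) ^+ 2 <= M) ->
  cvgn (series (fun n => c n *: x n)).
Proof.
move=> /(Bessel_synthesis_le Hdot)[B B0 xB] cM; apply/cvgn_rnormP => e e0.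
pose u := series (fun n => rnorm (c n) ^+ 2).
have cu : cvgn u.
  apply: nondecreasing_is_cvgn; last first.
    by exists M => _ [n _ <-]; rewrite /u seriesEnat; exact: cM.
  by apply: nondecreasing_series => n _ _; exact: sqr_ge0.
have eB0 : 0 < e ^+ 2 / B by rewrite divr_gt0 ?exprn_gt0.
have e20 : 0 < e ^+ 2 / B / 2 by rewrite divr_gt0.
have [N _ uN] := (cvgrPdist_lt _ _).1 cu _ e20.
exists N => n Nn.
have -> : series (fun n => c n *: x n) n - series (fun n => c n *: x n) N =
    \sum_(N <= k < n) c k *: x k by rewrite sub_series_geq.
rewrite -ltr_sqr ?nnegrE ?rnorm_ge0 ?ltW//.
apply: le_lt_trans (xB _ _ _ Nn) _; rewrite mulrC -ltr_pdivlMr//.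
have -> : \sum_(N <= k < n) rnorm (c k) ^+ 2 = u n - u N.
  by rewrite sub_series_geq.
have := uN N (leqnn N); have := uN n Nn; rewrite /= distrC.
move=> /(le_lt_trans (ler_norm _)) ? /(le_lt_trans (ler_norm _)) ?; lra.
Qed.

(** * Signed multipliers and their adjoints *)

(** Uniform boundedness applies to the finite subsums, indexed by cutoff and subset; a signed sum is
    a difference of two of them. *)
Lemma multiplier_signs_bounded (R : realType) (H : completeNormedModType R[i])
    (dot : {dot H for @Num.conj R[i]}) (Hdot : induces_norm dot)
    (m : nat -> R[i]) (phi psi : nat -> H) :
  multiplier_unconditionally_convergent dot m phi psi ->
  exists C : R, forall (N : nat) (p : pred nat) (f : H),
    rnorm (\sum_(0 <= n < N)
      (-1) ^+ p n *: multiplier_term dot m phi psi f n) <= C * rnorm f.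
Proof.
move=> muc; pose T (i : nat * pred nat) (f : H) :=
  \sum_(0 <= n < i.1 | i.2 n) multiplier_term dot m phi psi f n.
have [||f|C TC] := @uniform_boundedness R H H _ T.
- move=> [N p] a f g; rewrite /T /= scaler_sumr -big_split /=.
  apply: eq_bigr => n _; rewrite /multiplier_term [dot (_ + _) _]linearPl /=.
  by rewrite scalerA -scalerDl; congr (_ *: _); ring.
- move=> [N p]; exists (\sum_(0 <= n < N | p n)
    rnorm (m n) * rnorm (psi n) * rnorm (phi n)) => f.
  rewrite (le_trans (ler_rnorm_sum _ _ _))// mulr_suml.
  apply: ler_sum => n _; rewrite rnormZ rnormM.
  have : rnorm (m n) * rnorm (phi n) * rnorm (dot f (psi n)) <=
      rnorm (m n) * rnorm (phi n) * (rnorm f * rnorm (psi n)).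
    by rewrite ler_wpM2l ?mulr_ge0 ?rnorm_ge0// Cauchy_Schwarz.
  lra.
- have [M fM] := unconditional_subsums_bounded (muc f).
  by exists M => -[N p]; exact: fM.
exists (C + C) => N p f; rewrite sum_signsE mulrDl.
rewrite (le_trans (ler_rnormD _ _))// rnormN.
by apply: lerD; [exact: (TC (N, fun n => ~~ p n) f)|exact: (TC (N, p) f)].
Qed.

(** With [T] the signed sum and [u] its adjoint applied to [g], the squared norm of [u] is the
    modulus of [dot (T u) g], at most [C * rnorm u * rnorm g]. *)
Lemma adjoint_signs_bounded (R : realType) (H : completeNormedModType R[i])
    (dot : {dot H for @Num.conj R[i]}) (Hdot : induces_norm dot)
    (m : nat -> R[i]) (phi psi : nat -> H) (C : R) (N : nat) (p : pred nat) :
  (forall f : H, rnorm (\sum_(0 <= n < N)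
      (-1) ^+ p n *: multiplier_term dot m phi psi f n) <= C * rnorm f) ->
  forall g : H, rnorm (\sum_(0 <= n < N) (-1) ^+ p n *:
      multiplier_term dot (fun n => Num.conj (m n)) psi phi g n) <= C * rnorm g.
Proof.
move=> TC g; set u := (X in rnorm X).
(* [C] is not assumed nonnegative; for [u] zero, the bound at [g] itself shows that the right-hand
   side is. *)
have [u0|u0] := eqVneq (rnorm u) 0.
  have := TC g; move: (rnorm_ge0 (\sum_(0 <= n < N)
      (-1) ^+ p n *: multiplier_term dot m phi psi g n)).
  by rewrite u0; exact: le_trans.
have {u0}u0 : 0 < rnorm u by rewrite lt_neqAle rnorm_ge0 eq_sym u0.
have uE : dot u u = Num.conj (dot (\sum_(0 <= n < N)
    (-1) ^+ p n *: multiplier_term dot m phi psi u n) g).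
  rewrite {1}/u !linear_sumlz rmorph_sum /=; apply: eq_bigr => n _.
  rewrite !dotZl !rmorphM /= -!dotC rmorph_sign; ring.
rewrite -(ler_pM2r u0) -expr2.
have := rnorm_ge0 u; rewrite -(ger0_norm (sqr_ge0 _)) -rnorm_real -(dot_rnorm Hdot).
rewrite uE rnorm_conj (le_trans (Cauchy_Schwarz Hdot _ _))//.
by rewrite mulrAC ler_wpM2r ?rnorm_ge0.
Qed.

(** The inner product of [f] with the [n]-th vector has the modulus of the [n]-th multiplier term,
    and [sum_signs_ge] bounds the sum of the squares of these. *)
Lemma signs_bounded_sqr_sum (R : realType) (H : completeNormedModType R[i])
    (dot : {dot H for @Num.conj R[i]}) (Hdot : induces_norm dot)
    (m : nat -> R[i]) (phi psi : nat -> H) (C : R) :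
  (forall (N : nat) (p : pred nat) (f : H), rnorm (\sum_(0 <= n < N)
      (-1) ^+ p n *: multiplier_term dot m phi psi f n) <= C * rnorm f) ->
  Bessel dot (fun n => (Num.conj (m n) * `|phi n|) *: psi n).
Proof.
move=> TC; apply/BesselP; exists (C ^+ 2) => f N.
have [p le_p] := sum_signs_ge Hdot (multiplier_term dot m phi psi f) N.
rewrite -exprMn; apply: le_trans (_ : _ <= rnorm (\sum_(0 <= n < N)
  (-1) ^+ p n *: multiplier_term dot m phi psi f n) ^+ 2) _; last first.
  by rewrite ler_pXn2r ?nnegrE ?rnorm_ge0// (le_trans (rnorm_ge0 _) (TC N p f)).
apply: le_trans le_p; apply: ler_sum => n _.
by rewrite /multiplier_term dotZr rnormZ !rnormM rnorm_conj rnormM rnorm_conj rnorm_norm mulrAC.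
Qed.

(** * Lower bounds, rescaling and boundedness *)

Lemma norm_bounded_belowP (R : realType) (V : normedZmodType R[i])
    (x : nat -> V) :
  norm_bounded_below x <-> exists2 a : R, 0 < a & forall n, a <= rnorm (x n).
Proof.
split=> [inf0|[a a0 ax]].
  exists (inf (range (fun n => rnorm (x n)))) => // n.
  by apply: ge_inf; [exists 0 => _ [k _ <-]; exact: rnorm_ge0|exists n].
apply: lt_le_trans a0 _; apply: lb_le_inf; first by exists (rnorm (x 0)), 0%N.
by move=> _ [k _ <-].
Qed.

Lemma BesselZ (R : realType) (H : completeNormedModType R[i])
    (dot : {dot H for @Num.conj R[i]}) (x : nat -> H) (b : nat -> R[i]) (M : R) :
  (forall n, rnorm (b n) <= M) -> Bessel dot x -> Bessel dot (fun n => b n *: x n).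
Proof.
move=> bM /BesselP[B xB]; apply/BesselP; exists (M ^+ 2 * B) => h N.
rewrite -mulrA; apply: le_trans (ler_wpM2l (sqr_ge0 _) (xB h N)).
rewrite mulr_sumr; apply: ler_sum => n _.
rewrite dotZr rnormM rnorm_conj exprMn ler_wpM2r ?sqr_ge0//.
by rewrite ler_sqr ?nnegrE ?rnorm_ge0// (le_trans (rnorm_ge0 _) (bM n)).
Qed.

(** Testing the Bessel inequality on [x n] and keeping only the [n]-th term bounds the fourth power
    of its norm by [B] times the square. *)
Lemma Bessel_bounded (R : realType) (H : completeNormedModType R[i])
    (dot : {dot H for @Num.conj R[i]}) (Hdot : induces_norm dot) (x : nat -> H) :
  Bessel dot x -> exists b : R, forall n, rnorm (x n) <= b.
Proof.
move=> /BesselP[B xB]; exists (`|B| + 1) => n.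
have xB2 : (rnorm (x n) ^+ 2) ^+ 2 <= B * rnorm (x n) ^+ 2.
  apply: le_trans (xB (x n) n.+1); rewrite big_nat_recr//=.
  rewrite (dot_rnorm Hdot) rnorm_real ger0_norm ?sqr_ge0//.
  by rewrite lerDr sumr_ge0// => k _; exact: sqr_ge0.
have [->|x0] := eqVneq (rnorm (x n)) 0; first by rewrite addr_ge0.
have {}x0 : 0 < rnorm (x n) by rewrite lt_neqAle eq_sym x0 rnorm_ge0.
have : rnorm (x n) ^+ 2 <= B by rewrite -(ler_pM2r (exprn_gt0 2 x0)) -expr2.
have := ler_norm B; nra.
Qed.

(** * The implications between the three conditions *)

Lemma P1_P2 (R : realType) (H : completeNormedModType R[i])
    (dot : {dot H for @Num.conj R[i]}) (Hdot : induces_norm dot)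
    (m : nat -> R[i]) (phi psi : nat -> H) :
  P1 dot m phi psi -> P2 dot m phi psi.
Proof.
move=> [/norm_bounded_belowP[a a0 am] /(multiplier_signs_bounded Hdot)[C TC]].
have psiB := signs_bounded_sqr_sum Hdot TC.
have phiB := signs_bounded_sqr_sum Hdot
  (fun N p => adjoint_signs_bounded Hdot (TC N p)).
have {}am n : a <= rnorm (m n) * rnorm (phi n) * rnorm (psi n).
  by have := am n; rewrite !rnormM !rnorm_norm.
have phi0 n : 0 < rnorm (phi n).
  rewrite lt_neqAle rnorm_ge0 andbT eq_sym; apply/eqP => e.
  by have := am n; rewrite e mulr0 mul0r leNgt a0.
have phiN0 n : `|phi n| != 0 by rewrite normrE eq_complex /= gt_eqF.
have norm1 n : rnorm (`|phi n|^-1 *: phi n) = 1.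
  apply/eqP; rewrite -(inj_eq (@complexI _)) -normrE normrZ normfV normr_id.
  by rewrite mulVf.
exists (fun n => `|phi n|^-1), (fun n => Num.conj (m n) * `|phi n|); split.
- move=> n; rewrite rmorphM /= conjCK [Num.conj `|_|]conj_Creal ?normr_real//.
  by rewrite mulrCA mulVf ?mulr1.
- split; first by exists 1, 1; split=> // n; rewrite norm1 lexx.
  (* Dividing the Bessel sequence [phiB] by [m n] times both norms yields the normalized [phi n];
     the divisors have modulus at least [a]. *)
  have /(BesselZ (M := a^-1)) : forall n,
      rnorm ((Num.conj (Num.conj (m n)) * `|psi n|)^-1 * `|phi n|^-1) <= a^-1.
    move=> n; rewrite -invfM.
    set z := _ * _ * _.
    have zE : rnorm z = rnorm (m n) * rnorm (phi n) * rnorm (psi n).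
      by rewrite !rnormM !rnorm_norm !rnorm_conj mulrAC.
    have z0 : 0 < rnorm z by rewrite zE (lt_le_trans a0).
    have -> : rnorm z^-1 = (rnorm z)^-1.
      by apply: complexI; rewrite fmorphV /= -!normrE normfV.
    by rewrite lef_pV2 ?posrE// zE.
  move=> /(_ _ _ _ phiB); congr (Bessel _ _); apply/funext => n.
  rewrite scalerA mulrAC mulVf ?mul1r//.
  apply/eqP => z0; have := am n.
  suff -> : rnorm (m n) * rnorm (phi n) * rnorm (psi n) = 0 by rewrite leNgt a0.
  have : rnorm (Num.conj (Num.conj (m n)) * `|psi n|) = 0 by rewrite z0 rnorm0.
  by rewrite rnormM rnorm_norm !rnorm_conj mulrAC => ->; rewrite mul0r.
- split=> //; have [b psib] := Bessel_bounded Hdot psiB.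
  (* This norm is exactly the product that P1 bounds below; the upper bound [b] comes from being
     Bessel. *)
  have le_a n : a <= rnorm ((Num.conj (m n) * `|phi n|) *: psi n).
    by rewrite rnormZ rnormM rnorm_conj rnorm_norm.
  exists a, b; split=> //; first exact: le_trans (le_a 0%N) (psib 0%N).
  by move=> n; rewrite le_a psib.
Qed.

Lemma P2_P1 (R : realType) (H : completeNormedModType R[i])
    (dot : {dot H for @Num.conj R[i]}) (Hdot : induces_norm dot)
    (m : nat -> R[i]) (phi psi : nat -> H) :
  P2 dot m phi psi -> P1 dot m phi psi.
Proof.
move=> [c [d [mE [[a [? [a0 _ ac]]] cB] [[a' [? [a'0 _ ad]]] dB]]]]; split.
  (* The product of the three norms equals that of the norms of [c n *: phi n] and
     [d n *: psi n]. *)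
  apply/norm_bounded_belowP; exists (a * a'); first exact: mulr_gt0.
  move=> n; have /andP[{}ac _] := ac n; have /andP[{}ad _] := ad n.
  apply: le_trans (ler_pM (ltW a0) (ltW a'0) ac ad) _.
  rewrite !rnormZ !rnormM !rnorm_norm mE rnormM rnorm_conj.
  by rewrite mulrACA mulrA.
move=> f s /bij_inj sI.
have /BesselP[B sB] := Bessel_comp_inj sI dB.
suff -> : multiplier_term dot m phi psi f \o s =
    (fun n => dot f (d (s n) *: psi (s n)) *: (c (s n) *: phi (s n))).
  exact: Bessel_series_cvg (Bessel_comp_inj sI cB) (sB f).
apply/funext => n /=; rewrite /multiplier_term mE dotZr scalerA.
by congr (_ *: _); ring.
Qed.

Theorem proposition1p1 (R : realType) (H : completeNormedModType R[i])
    (dot : {dot H for @Num.conj R[i]}) (Hdot : induces_norm dot)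
    (e : nat -> H) (He : orthonormal_basis dot e) :
  (forall (m : nat -> R[i]) (phi psi : nat -> H),
     (P1 dot m phi psi <-> P2 dot m phi psi) /\
     (P2 dot m phi psi -> P3 dot m phi psi)) /\
  (exists (m : nat -> R[i]) (phi psi : nat -> H),
     P3 dot m phi psi /\ ~ P1 dot m phi psi).
Proof.
split=> [m phi psi|].
  split; first by split; [exact: P1_P2|exact: P2_P1].
  by move=> [c [d [mE [_ cB] [_ dB]]]]; exists c, d.
have B0 : Bessel dot (fun n => 0 *: (0 : H)).
  apply/BesselP; exists 0 => h N; rewrite mul0r big1// => n _.
  by rewrite scale0r linear0r rnorm0 expr0n.
(* P1 fails here through its lower bound alone, as all the products vanish. *)
exists (fun=> 0), (fun=> 0), (fun=> 0); split.
  by exists (fun=> 0), (fun=> 0); split=> // n; rewrite mul0r.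
move=> [/norm_bounded_belowP[a a0 /(_ 0%N)]].
by rewrite normr0 !mul0r rnorm0 leNgt a0.
Qed.
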